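(* For any connected graph $G$ of order $n \geq 2$, $$n + \lceil n/2 \rceil \leq \tilde{\gamma}_{c}(M(G \circ K_1)) \leq 2n.$$
   Context: All graphs are non-empty, finite, undirected and simple. The order of a graph is its number of vertices. The corona $G \circ K_1$ of a graph $G$ is the graph of order $2|V(G)|$ obtained from $G$ by adding a pendant edge (to a new vertex) at each vertex of $G$. A dominating set of a graph $H$ is a set $S \subseteq V(H)$ such that $N_H[v] \cap S \neq \emptyset$ for every $v \in V(H)$, where $N_H[v]$ is the closed neighborhood of $v$. A dominating set $S$ of $H$ is an outer-connected dominating set if the graph $H - S$ (obtained by deleting the vertices in $S$) is connected. The outer-connected domination number $\tilde{\gamma}_c(H)$ is the minimum cardinality of an outer-connected dominating set of $H$. The middle graph $M(G)$ of a graph $G$ is the graph with vertex set $V(G) \cup E(G)$ (disjoint union), in which two vertices $x,y$ are adjacent if and only if either $x,y \in E(G)$ are distinct edges sharing an endpoint in $G$, or one of them is a vertex of $G$ and the other is an edge of $G$ incident with it. *)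

(* Defs.v *)
From mathcomp Require Import all_boot.

Set Implicit Arguments.
Unset Strict Implicit.
Unset Printing Implicit Defensive.

(* Nonemptiness is not part of the record; it is required by [connected]. *)
Record sgraph := SGraph {
  vertex :> finType;
  adj : rel vertex;
  adj_sym : symmetric adj;
  adj_irr : irreflexive adj
}.
Arguments adj {s}.

Definition connected (G : sgraph) : bool :=
  (0 < #|G|) && [forall x : G, forall y : G, connect adj x y].

Section Induced.
Variables (G : sgraph) (A : {set G}).

Definition induced_adj : rel {x : G | x \in A} :=
  fun x y => adj (val x) (val y).

Lemma induced_adj_sym : symmetric induced_adj.
Proof. by move=> x y; apply: adj_sym. Qed.

Lemma induced_adj_irr : irreflexive induced_adj.
Proof. by move=> x; apply: adj_irr. Qed.

Definition induced : sgraph := SGraph induced_adj_sym induced_adj_irr.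
End Induced.

Definition delete (G : sgraph) (S : {set G}) : sgraph := induced (~: S).

Section Corona.
Variable G : sgraph.

(* [inl v] is the vertex v of G, [inr v] the new leaf attached to v. *)
Definition corona_adj : rel (G + G)%type := fun a b =>
  match a, b with
  | inl x, inl y => adj x y
  | inl x, inr y => x == y
  | inr x, inl y => x == y
  | inr _, inr _ => false
  end.

Lemma corona_adj_sym : symmetric corona_adj.
Proof. by move=> [x|x] [y|y] //=; rewrite 1?adj_sym // eq_sym. Qed.

Lemma corona_adj_irr : irreflexive corona_adj.
Proof. by move=> [x|x] //=; apply: adj_irr. Qed.

Definition corona : sgraph := SGraph corona_adj_sym corona_adj_irr.
End Corona.

Definition edges (G : sgraph) : {set {set G}} :=
  [set A | [exists x : G, exists y : G, adj x y && (A == [set x; y])]].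

Section Middle.
Variable G : sgraph.

Definition middle_adj : rel (G + {A : {set G} | A \in edges G})%type :=
  fun a b =>
  match a, b with
  | inl _, inl _ => false
  | inl x, inr A => x \in val A
  | inr A, inl x => x \in val A
  | inr A, inr B => (A != B) && (val A :&: val B != set0)
  end.

Lemma middle_adj_sym : symmetric middle_adj.
Proof. by move=> [x|A] [y|B] //=; rewrite eq_sym setIC. Qed.

Lemma middle_adj_irr : irreflexive middle_adj.
Proof. by move=> [x|A] //=; rewrite eqxx. Qed.

Definition middle : sgraph := SGraph middle_adj_sym middle_adj_irr.
End Middle.

Definition closed_nbh (G : sgraph) (v : G) : {set G} :=
  [set u | (u == v) || adj v u].

Definition dominating (G : sgraph) (S : {set G}) : bool :=
  [forall v : G, closed_nbh v :&: S != set0].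

Definition outer_connected_dominating (G : sgraph) (S : {set G}) : bool :=
  dominating S && connected (delete S).

(* If G has no outer-connected dominating set, this is the junk value #|G|;
   this happens only when G has an isolated vertex or is empty. *)
Definition oc_domination_number (G : sgraph) : nat :=
  #|[arg min_(S < [set: G] | outer_connected_dominating S) #|S|]|.

Lemma oc_domination_numberP (G : sgraph) (S0 : {set G}) :
  outer_connected_dominating S0 ->
  (exists2 S : {set G}, outer_connected_dominating S
                      & #|S| = oc_domination_number G)
  /\ forall S : {set G}, outer_connected_dominating S ->
       oc_domination_number G <= #|S|.
Proof.
move=> ocS0; rewrite /oc_domination_number /arg_min /extremum.
case: pickP => [S /andP[ocS /forallP minS]|none] /=.
  by split=> [|T ocT]; [exists S | have /implyP := minS T; apply].
case: (arg_minnP (fun S : {set G} => #|S|) ocS0) => S ocS minS.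
case/negP: (negbT (none S)); rewrite /= ocS /=.
by apply/forallP=> T; apply/implyP/minS.
Qed.

(* Main.v *)
Require Import Defs.
From mathcomp Require Import all_boot zify.

(** Upper bound: in the middle graph of any connected graph H with an edge, the
    vertices of H form a dominating set whose complement induces the line graph
    of H, which is connected ([oc_original_vertices]).  For the corona of G this
    set has order 2n.

    Lower bound: let S be an outer-connected dominating set of the middle graph
    of the corona.  The only neighbour of a leaf w is its pendant edge p, so S
    contains w or p.  If S contains p but not w, then w is isolated outside S,
    and connectedness forces S to be everything except w
    ([connected_delete_isolated]); since there are at least 3n vertices, S is
    then large enough.  Otherwise S contains all n leaves.  A leaf of the
    corona dominates no vertex v of G, so these n vertices have to be dominated
    by the rest of S; since each vertex of a middle graph dominates at most two
    original vertices, as an edge has only two endpoints, the rest of S has at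
    least n/2 elements ([dominated_originals_leq]). *)

Set Implicit Arguments.
Unset Strict Implicit.
Unset Printing Implicit Defensive.

(** * Edges and connectedness *)

Lemma edge_in_edges (H : sgraph) (x y : H) : adj x y -> [set x; y] \in edges H.
Proof.
by move=> xy; rewrite inE; apply/existsP; exists x; apply/existsP; exists y;
  rewrite xy eqxx.
Qed.

Definition edge (H : sgraph) (x y : H) (xy : adj x y) :
  {A : {set H} | A \in edges H} := exist _ [set x; y] (edge_in_edges xy).

Lemma edge_inhabited (H : sgraph) (A : {A : {set H} | A \in edges H}) :
  exists x, x \in val A.
Proof.
case: A => A /=; rewrite inE => /existsP[x /existsP[y /andP[_ /eqP->]]].
by exists x; rewrite set21.
Qed.

Lemma card_edge_leq2 (H : sgraph) (A : {A : {set H} | A \in edges H}) :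
  #|val A| <= 2.
Proof.
case: A => A /=; rewrite inE => /existsP[x /existsP[y /andP[_ /eqP->]]].
by rewrite cards2; case: (x != y).
Qed.

Lemma adj_connect_sym (H : sgraph) : connect_sym (@adj H).
Proof. exact/sym_connect_sym/adj_sym. Qed.

(** A path from w to a second vertex of H - S would have to leave w through a
    neighbour outside S. *)
Lemma connected_delete_isolated (H : sgraph) (S : {set H}) (w : H) :
  connected (delete S) -> w \notin S -> (forall u, adj w u -> u \in S) ->
  ~: S = [set w].
Proof.
move=> /andP[_ /forallP conS] wS nbw.
apply/setP=> u; rewrite !inE; apply/idP/eqP => [uS|->//].
have wS' : w \in ~: S by rewrite inE.
have uS' : u \in ~: S by rewrite inE.
have /forallP/(_ (exist _ u uS'))/connectP[[|z p] /=] := conS (exist _ w wS').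
  by move=> _ [].
case/andP=> wz _ _.
by move: (valP z); rewrite inE nbw.
Qed.

Lemma corona_connected (G : sgraph) : connected G -> connected (corona G).
Proof.
case/andP=> /card_gt0P[r _] /forallP conG; apply/andP; split.
  by apply/card_gt0P; exists (inl r).
have toR (a : corona G) : connect adj (inl r : corona G) a.
  have core x : connect adj (inl r : corona G) (inl x).
    have /forallP/(_ x)/connectP[p pP ->] := conG r.
    elim: p r pP => [|z p IH] y //= /andP[yz pP].
    exact: connect_trans (connect1 (yz : adj (inl y : corona G) (inl z))) (IH _ pP).
  case: a => x; first exact: core.
  by apply: connect_trans (core x) (connect1 _); rewrite /= eqxx.
apply/forallP=> a; apply/forallP=> b.
by apply: connect_trans (toR b); rewrite adj_connect_sym.
Qed.

(** * The original vertices of a middle graph *)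

Section MiddleOriginals.
Variable H : sgraph.

Definition originals : {set middle H} := [set inl x | x in [set: H]].

Lemma card_originals : #|originals| = #|H|.
Proof. by rewrite card_imset ?cardsT //; apply: inl_inj. Qed.

Lemma edge_notin_originals (A : {A : {set H} | A \in edges H}) :
  (inr A : middle H) \in ~: originals.
Proof. by rewrite inE; apply/imsetP=> [[]]. Qed.

Definition line_vertex (A : {A : {set H} | A \in edges H}) : delete originals :=
  exist _ (inr A : middle H) (edge_notin_originals A).

Lemma line_vertexP (a : delete originals) : exists A, a = line_vertex A.
Proof.
case: a => [[x|A] aP]; last by exists A; apply: val_inj.
by exfalso; move: aP; rewrite inE imset_f ?inE.
Qed.

Lemma connect_common_endpoint (x : H) (A B : {A : {set H} | A \in edges H}) :
  x \in val A -> x \in val B ->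
  connect adj (line_vertex A) (line_vertex B).
Proof.
move=> xA xB; have [->//|AB] := eqVneq A B.
apply: connect1; rewrite /= /induced_adj /= AB.
by apply/set0Pn; exists x; rewrite inE xA.
Qed.

(** A walk in H from an endpoint of A to an endpoint of B gives, through the
    edges that it traverses, a walk from A to B in the line graph. *)
Lemma connect_line (x y : H) (A B : {A : {set H} | A \in edges H}) :
  connect adj x y -> x \in val A -> y \in val B ->
  connect adj (line_vertex A) (line_vertex B).
Proof.
move=> /connectP[p pP ->{y}].
elim: p x A pP => [|z p IH] x A /=; first by move=> _; apply: connect_common_endpoint.
case/andP=> xz pP xA lB.
have xE : x \in val (edge xz) by rewrite set21.
have zE : z \in val (edge xz) by rewrite set22.
exact: connect_trans (connect_common_endpoint xA xE) (IH z _ pP zE lB).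
Qed.

Lemma oc_original_vertices (x y : H) : connected H -> adj x y ->
  outer_connected_dominating originals.
Proof.
case/andP=> _ /forallP conH xy; apply/andP; split.
  apply/forallP=> -[z|A]; apply/set0Pn.
    by exists (inl z); rewrite !inE eqxx imset_f ?inE.
  have [z zA] := edge_inhabited A.
  by exists (inl z); rewrite !inE /= zA imset_f ?inE.
apply/andP; split; first by apply/card_gt0P; exists (line_vertex (edge xy)).
apply/forallP=> a; apply/forallP=> b.
have [A ->] := line_vertexP a; have [B ->] := line_vertexP b.
have [u uA] := edge_inhabited A; have [v vB] := edge_inhabited B.
by have /forallP/(_ v)uv := conH u; apply: connect_line uv uA vB.
Qed.

Lemma card_dominated_originals_leq2 (t : middle H) :
  #|[set x : H | t \in closed_nbh (inl x : middle H)]| <= 2.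
Proof.
case: t => [y|A].
  apply: leq_trans (_ : #|[set y]| <= 2); last by rewrite cards1.
  apply/subset_leq_card/subsetP=> x.
  by rewrite !inE /= orbF => /eqP[->].
apply: leq_trans (card_edge_leq2 A); apply/subset_leq_card/subsetP=> x.
by rewrite !inE.
Qed.

(** The originals dominated by T are covered by the sets of originals that the
    single elements of T dominate. *)
Lemma dominated_originals_leq (X : {set H}) (T : {set middle H}) :
  (forall x, x \in X -> closed_nbh (inl x : middle H) :&: T != set0) ->
  #|X| <= 2 * #|T|.
Proof.
move=> domX.
pose D t := [set x : H | t \in closed_nbh (inl x : middle H)].
have XD : X \subset \bigcup_(t in T) D t.
  apply/subsetP=> x /domX/set0Pn[t /setIP[xt tT]].
  by apply/bigcupP; exists t; rewrite // inE.
apply: leq_trans (subset_leq_card XD) _.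
have -> : 2 * #|T| = \sum_(t in T) 2 by rewrite sum_nat_const mulnC.
apply: (big_rec2 (fun (E : {set H}) m => #|E| <= m)) => [|t m E _ Em].
  by rewrite cards0.
apply: leq_trans (leq_card_setU _ _) _.
exact: leq_add (card_dominated_originals_leq2 t) Em.
Qed.

End MiddleOriginals.

(** * The middle graph of a corona *)

Section MiddleCorona.
Variable G : sgraph.
Local Notation M := (middle (corona G)).

Definition core (x : G) : M := inl (inl x).
Definition leaf (x : G) : M := inl (inr x).

Lemma core_leaf_adj (x : G) : adj (inl x : corona G) (inr x).
Proof. exact: eqxx. Qed.

Definition pendant (x : G) : M := inr (edge (core_leaf_adj x)).

Lemma leaf_adj (x : G) (u : M) : adj (leaf x) u -> u = pendant x.
Proof.
case: u => [//|[A AE]] /= xA; congr inr; apply: val_inj => /=.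
move: xA AE; rewrite inE => xA /existsP[a /existsP[b /andP[]]] + /eqP AE.
move: xA; rewrite {}AE !inE => /orP[] /eqP<-; first case: b => //= b /eqP->.
  by rewrite setUC.
by case: a => //= a /eqP->.
Qed.

Definition leaves : {set M} := [set leaf x | x in [set: G]].

Lemma card_leaves : #|leaves| = #|G|.
Proof. by rewrite card_imset ?cardsT // => x y []. Qed.

Lemma pendant_inj : injective pendant.
Proof.
move=> x y /(congr1 (fun a : M => adj (leaf y) a)) /=.
by rewrite !inE /= eqxx => /eqP[].
Qed.

(** The originals account for 2n vertices, the pendant edges for n more. *)
Lemma card_middle_corona_geq : 3 * #|G| <= #|M|.
Proof.
have -> : #|M| = 2 * #|G| + #|{: {A : {set corona G} | A \in edges (corona G)}}|.
  by rewrite !card_sum mul2n addnn.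
rewrite -[3]/(2 + 1) mulnDl mul1n leq_add2l.
apply: (@leq_card _ _ (fun x => edge (core_leaf_adj x))) => x y xy.
by apply: pendant_inj; rewrite /pendant xy.
Qed.

(** If the leaf x is missing from S, its dominator is its pendant edge, so the
    leaf has no neighbour outside S. *)
Lemma leaf_or_cosingleton (S : {set M}) (x : G) :
  outer_connected_dominating S -> leaf x \notin S -> ~: S = [set leaf x].
Proof.
case/andP=> /forallP/(_ (leaf x))/set0Pn[t] + conS xS.
rewrite !inE => /andP[/orP[/eqP->|/leaf_adj->]]; first by rewrite (negPf xS).
move=> pS; apply: connected_delete_isolated conS xS _ => u.
by move=> /leaf_adj->.
Qed.

Lemma oc_dominating_corona_geq (S : {set M}) :
  0 < #|G| -> outer_connected_dominating S -> #|G| + uphalf #|G| <= #|S|.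
Proof.
move=> G_gt0 ocS; have [LS|] := boolP (leaves \subset S); last first.
  case/subsetPn=> _ /imsetP[x _ ->] /(leaf_or_cosingleton ocS) CS.
  (* S misses a single vertex, so its order is at least 3n - 1. *)
  by have := card_middle_corona_geq; have := cardsC S; rewrite CS cards1; lia.
rewrite -(cardsID leaves S) (setIidPr LS) card_leaves leq_add2l.
rewrite leq_uphalf_double -mul2n.
rewrite -[leqLHS]cardsT -(card_imset _ (@inl_inj G G)).
apply: (@dominated_originals_leq (corona G)) => _ /imsetP[x _ ->].
case/andP: ocS => /forallP/(_ (core x))/set0Pn[t /setIP[xt tS]] _.
apply/set0Pn; exists t; rewrite inE xt inE tS andbT.
by apply: contraL xt => /imsetP[y _ ->]; rewrite inE.
Qed.

End MiddleCorona.

Theorem theorem5p2 (G : sgraph) (n : nat) (hG : connected G) (hn : #|G| = n)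
    (n2 : 2 <= n) :
  n + uphalf n <= oc_domination_number (middle (corona G)) <= 2 * n.
Proof.
have G_gt0 : 0 < #|G| by rewrite hn ltnW.
have /card_gt0P[r _] := G_gt0.
have oc0 := oc_original_vertices (corona_connected hG) (core_leaf_adj r).
have [[S ocS cardS] /(_ _ oc0)] := oc_domination_numberP oc0.
rewrite card_originals card_sum addnn -mul2n hn => ->; rewrite andbT.
by rewrite -cardS -hn oc_dominating_corona_geq.
Qed.
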